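(* Let $P$ be a poset (resp., a dcpo) satisfying the following conditions: (i) the set $\mathrm{Id}_{\neg p}(P)$ of non-trivial ideals of $P$ is countable, say $\mathrm{Id}_{\neg p}(P)=\{I_n : n\in N\}$ with $N\subseteq\mathbb{N}$; (ii) for each $n\in N$ there is a strictly ascending sequence $c_{(n,1)}<c_{(n,2)}<\cdots<c_{(n,m)}<c_{(n,m+1)}<\cdots$ in $P$ such that $I_n=\mathord{\downarrow}\{c_{(n,m)} : m\in\mathbb{N}\}$; (iii) there is a countable family $\{T_l : l\in\mathbb{N}\}$ of subsets of $P$ such that $P\setminus\bigcup_{n\in N}H_n=\bigcup_{l\in\mathbb{N}}T_l$ and, for every $l\in\mathbb{N}$, every ideal of the poset $T_l$ (with the order restricted from $P$) is principal, i.e. $\mathrm{Id}(T_l)=\{\mathord{\downarrow}_{T_l}x : x\in T_l\}$; here $H_n=\{c_{(n,m)} : m\in\mathbb{N}\}\cup\{\bigvee_{m\in\mathbb{N}}c_{(n,m)}\}$ if $\bigvee_{m\in\mathbb{N}}c_{(n,m)}$ exists in $P$, and $H_n=\{c_{(n,m)} : m\in\mathbb{N}\}$ if it does not exist in $P$. Then $P$ is an $\ell f_\omega$-poset (resp., an $\ell f_\omega$-dcpo).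
   Context: A subset $D$ of a poset is directed if it is nonempty and any two elements of $D$ have an upper bound in $D$. A dcpo is a poset in which every directed subset has a supremum. For $A\subseteq P$, $\mathord{\downarrow}A=\{x\in P: x\le a\text{ for some }a\in A\}$ and $\mathord{\uparrow}A=\{x\in P: x\ge a\text{ for some }a\in A\}$. An ideal of a poset $P$ is a directed lower subset of $P$; $\mathrm{Id}(P)$ is the set of all ideals of $P$. The ideals $\mathord{\downarrow}x$ ($x\in P$) are principal; an ideal is non-trivial if it is not principal, and $\mathrm{Id}_{\neg p}(P)$ is the set of non-trivial ideals. Scott topology: $U\subseteq P$ is Scott open if $U=\mathord{\uparrow}U$ and, for every directed $D\subseteq P$ such that $\bigvee D$ exists, $\bigvee D\in U$ implies $D\cap U\neq\emptyset$. These sets form the topology $\sigma(P)$; $\Sigma P=(P,\sigma(P))$. A d-sub-poset of a poset $T$ is a subset $S\subseteq T$ with the restricted order such that $\bigvee_T D\in S$ for every directed $D\subseteq S$ for which $\bigvee_T D$ exists. A sub-dcpo of a dcpo $T$ is a subset $S$ with the restricted order such that $\bigvee_T D\in S$ for every directed $D\subseteq S$. A $T_0$ space $X$ is locally finite if for each $x\in X$ and each open neighborhood $U$ of $x$ there is a nonempty finite $F\subseteq X$ such that $\mathord{\uparrow}F$ (taken in the specialization order $x\le y\iff x\in\overline{\{y\}}$) is open and $x\in\mathord{\uparrow}F\subseteq U$. A poset (resp., dcpo) $P$ is an $\ell f_\omega$-poset (resp., $\ell f_\omega$-dcpo) if there is a sequence $(K_n)_{n\in\mathbb{N}}$ of d-sub-posets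 (resp., sub-dcpos) of $P$ such that: (a) $\Sigma K_n$ is locally finite for every $n$; (b) $K_n\subseteq K_m$ whenever $n\le m$; (c) $P=\bigcup_n K_n$; (d) $U\subseteq P$ is Scott open in $P$ iff $U\cap K_n$ is Scott open in $K_n$ for each $n$. *)

(* Defs.v *)
From HB Require Import structures.
From mathcomp Require Import all_boot all_order.
From mathcomp Require Import all_classical.
From mathcomp Require Import topology.
Set Implicit Arguments.
Unset Strict Implicit.
Unset Printing Implicit Defensive.
Import Order.TTheory.
Local Open Scope order_scope.
Local Open Scope classical_set_scope.

Section Poset.
Context {d : Order.disp_t} {P : porderType d}.
Implicit Types (A D S U : set P) (x y z : P).

Definition up A : set P := [set x | exists2 a, A a & a <= x].

Definition directed D : Prop :=
  D !=set0 /\ forall x y, D x -> D y -> exists2 z, D z & x <= z /\ y <= z.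

Definition ideal A : Prop := directed A /\ A = down A.

Definition principal_ideal x : set P := down [set x].

Definition nontrivial_ideal A : Prop :=
  ideal A /\ ~ range principal_ideal A.

(* "The supremum of D exists and is x" is [supremums D x]. *)
Definition scott_open U : Prop :=
  U = up U /\
  forall D, directed D -> forall x, supremums D x -> U x -> D `&` U !=set0.

(* Directedness only involves elements of D, so D is directed in S for the
   restricted order iff it is directed in P. *)
Definition d_sub_poset S : Prop :=
  forall D, D `<=` S -> directed D -> forall x, supremums D x -> S x.

End Poset.

Definition dcpo d (P : porderType d) : Prop :=
  forall D : set P, directed D -> supremums D !=set0.

(* Meant for S a subset of a dcpo. *)
Definition sub_dcpo d (P : porderType d) (S : set P) : Prop :=
  forall D : set P, D `<=` S -> directed D -> exists2 x, supremums D x & S x.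

(* The subset A as a poset of its own, with the order restricted from P. *)
Definition subposet d (P : porderType d) (A : set P) : Type := set_type A.

Section Subposet.
Context {d : Order.disp_t} {P : porderType d} (A : set P).
HB.instance Definition _ := SubChoice.copy (subposet A) (set_type A).
HB.instance Definition _ := [SubChoice_isSubPOrder of subposet A by <: with d].

Lemma subposet_leE (x y : subposet A) : (x <= y) = (val x <= val y).
Proof. by []. Qed.
End Subposet.

(* The Scott space of P: the carrier of P, with the Scott topology. *)
Definition Scott d (P : porderType d) : Type := P.

Section ScottTopology.
Context {d : Order.disp_t} {P : porderType d}.

Let scott_openT : scott_open [set: P].
Proof.
split=> [|D [[x Dx] _] _ _ _]; last by exists x.
by apply/seteqP; split=> // x _; exists x.
Qed.

Let scott_openI : setI_closed (@scott_open d P).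
Proof.
move=> U V [Uup oU] [Vup oV]; split.
  apply/seteqP; split=> [x UVx|x [a [Ua Va] ax]]; first by exists x.
  by split; [rewrite Uup; exists a|rewrite Vup; exists a].
move=> D dD x Dx [Ux Vx].
have [u [Du Uu]] := oU D dD x Dx Ux.
have [v [Dv Vv]] := oV D dD x Dx Vx.
have [w Dw [uw vw]] := dD.2 u v Du Dv.
by exists w; split=> //; split; [rewrite Uup; exists u|rewrite Vup; exists v].
Qed.

Let scott_open_bigU (J : Type) (f : J -> set P) :
  (forall j, scott_open (f j)) -> scott_open (\bigcup_j f j).
Proof.
move=> of_; split.
  apply/seteqP; split=> [x fx|x [a [j _ fa] ax]]; first by exists x.
  by exists j => //; rewrite (of_ j).1; exists a.
move=> D dD x Dx [j _ fx]; have [y [Dy fy]] := (of_ j).2 D dD x Dx fx.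
by exists y; split=> //; exists j.
Qed.

HB.instance Definition _ := Choice.copy (Scott P) P.
HB.instance Definition _ := isOpenTopological.Build (Scott P)
  scott_openT scott_openI scott_open_bigU.

Lemma scott_openE : @open (Scott P) = @scott_open d P.
Proof. by []. Qed.
End ScottTopology.

Section LocallyFinite.
Variable X : topologicalType.

(* Specialization order: x lies below y. *)
Definition spec_le (x y : X) : Prop := closure [set y] x.

Definition spec_up (F : set X) : set X :=
  [set x | exists2 a, F a & spec_le a x].

Definition locally_finite : Prop :=
  kolmogorov_space X /\
  forall (x : X) (U : set X), open U -> U x ->
    exists F : set X, [/\ F !=set0, finite_set F, open (spec_up F),
      spec_up F x & spec_up F `<=` U].
End LocallyFinite.

Section LfOmega.
Context {d : Order.disp_t} (P : porderType d).

Definition lf_omega_seq (K : nat -> set P) : Prop :=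
  [/\ forall n, locally_finite (Scott (subposet (K n))),
      forall n m, (n <= m)%N -> K n `<=` K m,
      [set: P] = \bigcup_n K n &
      forall U : set P, scott_open U <->
        forall n, scott_open ((val : subposet (K n) -> P) @^-1` U)].

Definition lf_omega_poset : Prop :=
  exists K : nat -> set P, (forall n, d_sub_poset (K n)) /\ lf_omega_seq K.

Definition lf_omega_dcpo : Prop :=
  dcpo P /\
  exists K : nat -> set P, (forall n, sub_dcpo (K n)) /\ lf_omega_seq K.

(* [supremums A] is a singleton if A has a supremum, and empty otherwise. *)
Definition with_sup (c : nat -> P) : set P :=
  range c `|` supremums (range c).
End LfOmega.

(* Main.v *)
Require Import Defs.
From mathcomp Require Import all_boot all_order.
From mathcomp Require Import all_classical.
From mathcomp Require Import topology.
From mathcomp Require wochoice.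

(** A directed set without greatest element has a non-principal lower closure,
    so it is cofinal with one of the chains [c i], and its supremum, if any, is
    that of [c i].  Scott openness is therefore decided on the chains alone.

    [K n] is the union of the [H_i] and of sets [S i] for [i <= n], and of the
    [T l] for [l <= n].  In a finite cover of a directed set some piece meets it
    cofinally ([directed_cover_cofinal]).  A piece in which every directed set
    has a greatest element cannot do so for a set without greatest element, so
    in [K n] the finitely many chains [c i] with [i <= n] suffice
    ([carried_bigcup]).  This makes [K n] closed under suprema, and locally
    finite: inside an open set, the upper set generated by a point is open once
    one generator is added for each of these chains whose supremum lies in the
    open set ([scott_locally_finite]).

    The [S i] make Scott openness pass from P to [K n].  If [c i] has no supremum in P, it
    may have one in a subset such as the union of the [H_i] and [T l], and then
    the trace of a Scott open set may fail to be Scott open.  So [S i] is a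
    coinitial set of upper bounds of [c i], which prevents this
    ([carried_supremums]).  It can be chosen so that its directed sets have
    greatest elements ([noetherian_coinitial]), and hence brings no new chain
    into [K n]. *)

Import Order.TTheory.
Local Open Scope order_scope.
Local Open Scope classical_set_scope.

(** * Directed sets and their lower closures *)

Definition has_greatest {d} {P : porderType d} (A : set P) : Prop :=
  exists2 m, A m & ubound A m.

Lemma sub_down {d} {P : porderType d} (A : set P) : A `<=` down A.
Proof. by move=> x Ax; exists x. Qed.

Lemma down_subr {d} {P : porderType d} (A B : set P) :
  A `<=` down B -> down A `<=` down B.
Proof.
move=> AB x [a [Aa xa]]; have [b [Bb ab]] := AB a Aa.
by exists b; split => //; apply: le_trans ab.
Qed.

Lemma ubound_down {d} {P : porderType d} (A : set P) :
  ubound (down A) = ubound A.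
Proof.
apply/seteqP; split=> u uA x; first by move=> Ax; apply/uA/sub_down.
by move=> [a [Aa xa]]; apply: le_trans xa (uA _ Aa).
Qed.

Lemma supremums_down {d} {P : porderType d} (A B : set P) :
  down A = down B -> supremums A = supremums B.
Proof. by move=> AB; rewrite /supremums -(ubound_down A) AB ubound_down. Qed.

Lemma greatest_supremums {d} {P : porderType d} (A : set P) m x :
  A m -> ubound A m -> supremums A x -> x = m.
Proof. by move=> Am mA [xA lx]; apply/le_anti; rewrite lx // xA. Qed.

Lemma directed_cofinal {d} {P : porderType d} (D E : set P) :
  directed D -> E `<=` D -> D `<=` down E -> directed E.
Proof.
move=> [[x0 Dx0] dD] ED DE; split.
  by have [e [Ee _]] := DE _ Dx0; exists e.
move=> x y /ED Dx /ED Dy; have [z /DE[e [Ee ze]] [xz yz]] := dD x y Dx Dy.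
by exists e => //; split; apply: le_trans ze.
Qed.

Lemma directed_down {d} {P : porderType d} (D : set P) :
  directed D -> directed (down D).
Proof.
move=> [D0 dD]; split; first by case: D0 => x Dx; exists x; apply: sub_down.
move=> x y [a [Da xa]] [b [Db yb]]; have [z Dz [az bz]] := dD a b Da Db.
by exists z; [apply: sub_down | split; [exact: le_trans az | exact: le_trans bz]].
Qed.

Lemma ideal_down {d} {P : porderType d} (D : set P) :
  directed D -> ideal (down D).
Proof.
move=> dD; split; first exact: directed_down.
by apply/seteqP; split; [exact: sub_down | apply: down_subr].
Qed.

Lemma principal_greatest {d} {P : porderType d} (D : set P) x :
  down D = principal_ideal x -> has_greatest D.
Proof.
move=> Dx; have [a [Da xa]] : down D x by rewrite Dx; apply: sub_down.
exists a => // y /sub_down; rewrite Dx => -[_ [-> yx]].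
exact: le_trans xa.
Qed.

Lemma directed_finite_ub {d} {P : porderType d} (D : set P) (s : seq P) :
  directed D -> (forall x, x \in s -> D x) ->
  exists2 z, D z & forall x, x \in s -> x <= z.
Proof.
move=> [[x0 Dx0] dD]; elim: s => [|a s IH] Ds; first by exists x0.
have [z Dz sz] := IH (fun x xs => Ds x (mem_behead (s := a :: s) xs)).
have [w Dw [aw zw]] := dD a z (Ds a (mem_head a s)) Dz.
exists w => // x; rewrite inE => /orP[/eqP->//|/sz xz]; exact: le_trans zw.
Qed.

(** If no piece met D cofinally, each piece would miss all elements of D above
    some d in D; an upper bound in D of these finitely many d would lie in no
    piece. *)
Lemma directed_cover_cofinal {d} {P : porderType d} (F : set (set P))
    (D : set P) :
  finite_set F -> directed D -> D `<=` \bigcup_(A in F) A ->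
  exists2 A, F A & D `<=` down (D `&` A).
Proof.
move=> /finite_seqP[s ->{F}] dD DF; apply: contrapT => nF.
have [[x0 _] _] := dD.
have [f fP] : exists f : set P -> P,
    forall A, A \in s -> D (f A) /\ ~ down (D `&` A) (f A).
  suff /choice[f fP] : forall A : set P, exists x : P,
      A \in s -> D x /\ ~ down (D `&` A) x by exists f.
  move=> A; have [As|] := boolP (A \in s); last by exists x0.
  apply: contrapT => nx; apply: nF; exists A => // x Dx.
  by apply: contrapT => nDx; apply: nx; exists x.
have [|z Dz fz] := directed_finite_ub D [seq f A | A <- s] dD.
  by move=> _ /mapP[A /fP[DA _] ->].
have [A As Az] := DF z Dz.
by have [_] := fP A As; apply; exists z; split=> //; apply/fz/map_f.
Qed.

(** * Sets without non-principal ideals *)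

(** For a poset this is the ascending chain condition. *)
Definition noetherian {d} {P : porderType d} (A : set P) : Prop :=
  forall D, D `<=` A -> directed D -> has_greatest D.

(** Directedness and greatest elements do not change when a subset of A is seen
    in A as a poset of its own, so it suffices to look at the lower closure of
    D in A. *)
Lemma principal_ideals_noetherian {d} {P : porderType d} (A : set P) :
  (forall B : set (subposet A), ideal B -> range principal_ideal B) ->
  noetherian A.
Proof.
move=> AP D DA [[x0 Dx0] dD].
pose inA x (Dx : D x) : subposet A := exist _ x (mem_set (DA x Dx)).
pose D' : set (subposet A) := (val : subposet A -> P) @^-1` D.
have [|x _ Dx] := AP (down D'); first apply: ideal_down.
  split; first by exists (inA x0 Dx0).
  move=> x y D'x D'y; have [z Dz xyz] := dD _ _ D'x D'y.
  by exists (inA z Dz).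
have [m D'm mD'] := principal_greatest D' x (esym Dx).
by exists (val m) => // y Dy; apply: (mD' (inA y Dy)).
Qed.

(** Well-order P and keep the elements of B that are above no earlier element
    of B.  Each b in B is above a kept one, namely the earliest element below
    b.  On the kept elements, larger means earlier, so the earliest element of
    a directed set is its greatest. *)
Lemma noetherian_coinitial {d} {P : porderType d} (B : set P) :
  exists S : set P, [/\ S `<=` B, noetherian S &
    forall b, B b -> exists2 s, S s & s <= b].
Proof.
have [R woR] := wochoice.well_ordering_principle P.
have first_of (A : set P) : A !=set0 -> exists2 z, A z & forall x, A x -> R z x.
  move=> [a Aa]; have [|z [[zA Rz] _]] := woR (mem A).
    by exists a; apply: mem_set.
  by exists z; [exact: set_mem | move=> x Ax; apply/Rz/mem_set].
have R_anti x y : R x y -> R y x -> x = y.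
  move=> Rxy Ryx; have [|z [_ uz]] := woR (mem [set x; y]).
    by exists x; rewrite inE; left.
  have Rrefl t : R t t by have [|_ -> ->] := first_of [set t]; first by exists t.
  rewrite -(uz x) ?(uz y) //; split; rewrite ?inE; try by [left|right].
    by move=> t; rewrite inE => -[->|->].
  by move=> t; rewrite inE => -[->|->].
pose S : set P := [set x | B x /\ forall y, B y -> y <= x -> R x y].
exists S; split=> [x []//|D DS [D0 dD]|b Bb].
  have [m Dm Rm] := first_of D D0; exists m => // x Dx.
  have [z Dz [xz mz]] := dD x m Dx Dm.
  have [Bm _] := DS m Dm; have [_ Rz] := DS z Dz.
  by rewrite (R_anti m z) ?Rm ?Rz.
have [|z [Bz zb] Rz] := first_of [set y | B y /\ y <= b]; first by exists b.
exists z => //; split=> // y By yz; apply: Rz; split=> //.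
exact: le_trans zb.
Qed.

(** * Scott spaces *)

Lemma scott_open_nle {d} {Q : porderType d} (y : Q) :
  scott_open [set z | ~ z <= y].
Proof.
split; first apply/seteqP; first split=> [x xy|x [a ay ax] xy].
- by exists x.
- by apply: ay; apply: le_trans xy.
move=> D dD x [_ lx] xy; apply: contrapT => nD; apply: xy; apply: lx => z Dz.
by apply: contrapT => zy; apply: nD; exists z.
Qed.

Lemma scott_spec_le {d} {Q : porderType d} (x y : Scott Q) :
  spec_le x y <-> (x : Q) <= (y : Q).
Proof.
split=> [xy|xy B].
  apply: contrapT => nxy.
  have [|z [-> /=]] := xy [set z | ~ (z : Q) <= (y : Q)]; last by rewrite lexx.
  apply: open_nbhs_nbhs; split=> //; exact: scott_open_nle.
rewrite nbhsE => -[U [[Uup _] Ux] UB]; exists y; split=> //.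
by apply: UB; rewrite Uup; exists x.
Qed.

Lemma scott_spec_up {d} {Q : porderType d} (F : set (Scott Q)) :
  spec_up F = up (F : set Q).
Proof.
by apply/seteqP; split=> x [a Fa /scott_spec_le ax]; exists a.
Qed.

Lemma scott_kolmogorov {d} {Q : porderType d} : kolmogorov_space (Scott Q).
Proof.
have sep (x y : Q) : ~ x <= y ->
    exists A : set (Scott Q), A \in nbhs (x : Scott Q) /\ y \in (~` A).
  move=> xy; exists [set z | ~ (z : Q) <= y]; split.
    apply: mem_set; apply: open_nbhs_nbhs; split=> //; exact: scott_open_nle.
  by apply: mem_set => /=; rewrite lexx.
move=> x y xy; have [yx|/sep[A ?]] := pselect ((x : Q) <= y); last first.
  by exists A; left.
have [xy'|/sep[A ?]] := pselect ((y : Q) <= x); last by exists A; right.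
by case/eqP: xy; apply/le_anti; rewrite yx xy'.
Qed.

(** An upper set is Scott open as soon as it meets those E j whose supremum it
    contains.  To put such a set around x inside an open U, one generator in
    each E j whose supremum lies in U is enough, besides x. *)
Lemma scott_locally_finite {d} {Q : porderType d} {J : Type} (A : set J)
    (E : J -> set Q) :
  finite_set A -> (forall j, A j -> directed (E j)) ->
  (forall D, directed D -> ~ has_greatest D ->
    exists2 j, A j & down D = down (E j)) ->
  locally_finite (Scott Q).
Proof.
move=> finA dE DE; split; first exact: scott_kolmogorov.
move=> x U [Uup oU] Ux.
have [f fP] : exists f : J -> Q, forall j, A j ->
    U (f j) /\ (forall s, supremums (E j) s -> U s -> E j (f j)).
  suff /choice[f fP] : forall j, exists y : Q, A j ->
      U y /\ (forall s, supremums (E j) s -> U s -> E j y) by exists f.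
  move=> j; have [[Aj [s sE Us]]|nj] :=
    pselect (A j /\ exists2 s, supremums (E j) s & U s).
    by have [y [Ey Uy]] := oU _ (dE j Aj) s sE Us; exists y.
  (* no supremum of E j lies in U, so any element of U will do *)
  by exists x => Aj; split=> // s sE Us; case: nj; split=> //; exists s.
pose F : set Q := x |` [set f j | j in A].
have FU : up F `<=` U.
  move=> z [a Fa az]; rewrite Uup; exists a => //.
  by case: Fa => [->//|[j Aj <-]]; have [] := fP j Aj.
exists F; rewrite scott_spec_up; split=> //.
- by exists x; left.
- by rewrite finite_setU; split; [exact: finite_set1 | exact: finite_image].
- split.
    apply/seteqP; split=> [z Fz|z [a [b Fb ba] az]]; first by exists z.
    by exists b => //; apply: le_trans az.
  move=> D dD s sD Fs; have [[m Dm mD]|ngD] := pselect (has_greatest D).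
    by exists m; split=> //; rewrite -(greatest_supremums _ _ _ Dm mD sD).
  have [j Aj Dj] := DE D dD ngD.
  have [_ /(_ s)] := fP j Aj; rewrite -(supremums_down _ _ Dj).
  move=> /(_ sD (FU _ Fs)) /sub_down; rewrite -Dj => -[y [Dy fy]].
  by exists y; split=> //; exists (f j) => //; right; exists j.
- by exists x => //; left.
Qed.

(** * Directed subsets of a set carried by finitely many chains *)

Lemma chain_directed {d} {P : porderType d} (c : nat -> P) :
  {homo c : m n / (m <= n)%N >-> m <= n} -> directed (range c).
Proof.
move=> cM; split; first by exists (c 0), 0.
move=> _ _ [m _ <-] [n _ <-]; exists (c (maxn m n)); first by exists (maxn m n).
by split; apply: cM; rewrite ?leq_maxl ?leq_maxr.
Qed.

(** The supremum of the chain, if it were in D, would be the greatest element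
    of D.  So D lies in the chain itself, and its indices are unbounded. *)
Lemma with_sup_cofinal {d} {P : porderType d} (c : nat -> P) (D : set P) :
  {homo c : m n / (m <= n)%N >-> m <= n} ->
  D `<=` with_sup c -> directed D -> ~ has_greatest D ->
  down D = down (range c).
Proof.
move=> cM Dc [[x0 Dx0] _] ngD.
have Dran : D `<=` range c.
  move=> s Ds; have [//|[sc _]] := Dc s Ds.
  case: ngD; exists s => // x Dx.
  have [/sc//|[_ lx]] := Dc x Dx; exact: lx.
apply/seteqP; split; apply: down_subr => x; first by move=> /Dran/sub_down.
move=> [m _ <-]; suff [k mk Dk] : exists2 k, (m <= k)%N & D (c k).
  by exists (c k); split=> //; apply: cM.
elim: m => [|m [k mk Dk]].
  by have [k _ ck] := Dran _ Dx0; exists k; rewrite ?ck.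
have [y Dy yk] : exists2 y, D y & ~ y <= c k.
  apply: contrapT => nk; apply: ngD; exists (c k) => // y Dy.
  by apply: contrapT => yk; apply: nk; exists y.
have [k' _ ck'] := Dran y Dy; exists k'; rewrite ?ck' //.
rewrite ltnNge; apply/negP => k'm; apply: yk; rewrite -ck'.
exact/cM/(leq_trans k'm).
Qed.

(** This localizes to K the hypothesis on the non-trivial ideals of P.  P itself
    may need all chains; the point of the sets K used below is that finitely
    many indices are enough for each. *)
Definition carried {d} {P : porderType d} {X : Type} (J : set X)
    (c : X -> nat -> P) (K : set P) : Prop :=
  forall D, D `<=` K -> directed D -> ~ has_greatest D ->
    exists2 i, J i & down D = down (range (c i)).

Lemma carried_bigcup {d} {P : porderType d} {X : Type} (J : set X)
    (c : X -> nat -> P) (F : set (set P)) :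
  (forall i, {homo c i : m n / (m <= n)%N >-> m <= n}) -> finite_set F ->
  (forall A, F A -> noetherian A \/ exists2 i, J i & A = with_sup (c i)) ->
  carried J c (\bigcup_(A in F) A).
Proof.
move=> cM finF FP D DF dD ngD.
have [A FA DA] := directed_cover_cofinal F D finF dD DF.
have ED : D `&` A `<=` D by move=> ? [].
have EA : D `&` A `<=` A by move=> ? [].
have dE := directed_cofinal _ _ dD ED DA.
have ngE : ~ has_greatest (D `&` A).
  move=> [m [Dm Am] mE]; apply: ngD; exists m => // x /DA[e [Ee xe]].
  exact: le_trans xe (mE e Ee).
have [noeA|[i Ji Ai]] := FP A FA; first by case: ngE; apply: noeA.
exists i => //; rewrite -(with_sup_cofinal (c i) (D `&` A)) //; last first.
  by rewrite -Ai.
apply/seteqP; split; apply: down_subr => // x /ED; exact: sub_down.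
Qed.

Lemma carried_d_sub_poset {d} {P : porderType d} {X : Type} (J : set X)
    (c : X -> nat -> P) (K : set P) :
  carried J c K -> (forall i, J i -> with_sup (c i) `<=` K) -> d_sub_poset K.
Proof.
move=> cK sK D DK dD x sD; have [[m Dm mD]|ngD] := pselect (has_greatest D).
  by rewrite (greatest_supremums _ _ _ Dm mD sD); apply: DK.
have [i Ji Di] := cK D DK dD ngD; apply: (sK i Ji); right.
by rewrite -(supremums_down _ _ Di).
Qed.

Lemma subposet_directed {d} {P : porderType d} (K : set P)
    (D : set (subposet K)) :
  directed D -> directed (val @` D).
Proof.
move=> [[x0 Dx0] dD]; split; first by exists (val x0), x0.
move=> _ _ [x Dx <-] [y Dy <-]; have [z Dz xyz] := dD x y Dx Dy.
by exists (val z) => //; exists z.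
Qed.

Lemma subposet_greatest {d} {P : porderType d} (K : set P)
    (D : set (subposet K)) :
  has_greatest (val @` D) -> has_greatest D.
Proof.
move=> [_ [m Dm <-] mD]; exists m => // x Dx; apply: mD; by exists x.
Qed.

Lemma subposet_sub {d} {P : porderType d} (K : set P) (x : subposet K) :
  K (val x).
Proof. exact: set_mem (valP x). Qed.

Lemma subposet_preimage_directed {d} {P : porderType d} (K D : set P) :
  D `<=` K -> directed D -> directed ((val : subposet K -> P) @^-1` D).
Proof.
move=> DK [[x Dx] dD]; split; first by exists (exist _ x (mem_set (DK x Dx))).
move=> a b Da Db; have [z Dz abz] := dD _ _ Da Db.
by exists (exist _ z (mem_set (DK z Dz))).
Qed.

Lemma carried_locally_finite {d} {P : porderType d} {X : Type} (J : set X)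
    (c : X -> nat -> P) (K : set P) :
  (forall i, {homo c i : m n / (m <= n)%N >-> m <= n}) -> finite_set J ->
  carried J c K -> (forall i, J i -> with_sup (c i) `<=` K) ->
  locally_finite (Scott (subposet K)).
Proof.
move=> cM finJ cK sK.
have inK i m : J i -> exists y : subposet K, val y = c i m.
  move=> Ji; have Kc : K (c i m) by apply: (sK i Ji); left; exists m.
  by exists (exist _ (c i m) (mem_set Kc)).
apply: (scott_locally_finite J
  (fun i => (val : subposet K -> P) @^-1` range (c i))) => // [i Ji|D dD ngD].
  apply: subposet_preimage_directed; last exact: chain_directed.
  by move=> x cx; apply: (sK i Ji); left.
have [||i Ji Di] := cK _ _ (subposet_directed _ _ dD).
- by move=> _ [x _ <-]; apply: subposet_sub.
- by move/subposet_greatest.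
exists i => //; apply/seteqP; split; apply: down_subr => x.
  move=> Dx; have : down (val @` D) (val x) by apply: sub_down; exists x.
  rewrite Di => -[_ [[m _ <-] xm]]; have [y yE] := inK i m Ji.
  by exists y; split; [exists m | rewrite subposet_leE yE].
move=> cx; have : down (range (c i)) (val x) by exact: sub_down.
rewrite -Di => -[_ [[y Dy <-] xy]].
by exists y.
Qed.

(** In K a chain could acquire a supremum that it lacks in P, if all upper bounds
    not above some element of K are left out.  This cannot happen when K keeps
    a coinitial part of the upper bounds of each chain that carries it. *)
Lemma carried_supremums {d} {P : porderType d} {X : Type} (J : set X)
    (c : X -> nat -> P) (K : set P) (D : set (subposet K)) x :
  carried J c K ->
  (forall i b, J i -> ubound (range (c i)) b ->
    exists2 s, K s & ubound (range (c i)) s /\ s <= b) ->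
  directed D -> supremums D x -> supremums (val @` D) (val x).
Proof.
move=> cK coK dD sD; have [[m Dm mD]|ngD] := pselect (has_greatest D).
  rewrite (greatest_supremums _ _ _ Dm mD sD); split.
    by move=> _ [y Dy <-]; apply: mD.
  by move=> u; apply; exists m.
have [||i Ji Di] := cK _ _ (subposet_directed _ _ dD).
- by move=> _ [y _ <-]; apply: subposet_sub.
- by move/subposet_greatest.
case: sD => xD lx; split; first by move=> _ [y Dy <-]; apply: xD.
move=> u; rewrite -ubound_down Di ubound_down => /(coK i u Ji)[s Ks [cs su]].
apply: le_trans su; apply: (lx (exist _ s (mem_set Ks))) => y Dy.
by move: cs; rewrite -ubound_down -Di ubound_down; apply; exists y.
Qed.

(** * Scott open sets in an increasing union *)

(** Restriction to [K n] preserves Scott openness because suprema in [K n] are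
    suprema in P.  Conversely, if the supremum of a directed D lies in U, either
    it belongs to D, or D is cofinal with some [c i]; then some [K n] contains
    [c i] together with its supremum, and openness in that [K n] is enough. *)
Lemma scott_open_bigcup {d} {P : porderType d} {X : Type} (c : X -> nat -> P)
    (J : nat -> set X) (K : nat -> set P) :
  (forall i, {homo c i : m n / (m <= n)%N >-> m <= n}) ->
  carried setT c [set: P] ->
  (forall n, carried (J n) c (K n)) ->
  (forall n i, J n i -> with_sup (c i) `<=` K n) ->
  (forall n i b, J n i -> ubound (range (c i)) b ->
    exists2 s, K n s & ubound (range (c i)) s /\ s <= b) ->
  (forall i, exists n, J n i) ->
  (forall n m, (n <= m)%N -> K n `<=` K m) ->
  [set: P] = \bigcup_n K n ->
  forall U : set P, scott_open U <->
    forall n, scott_open ((val : subposet (K n) -> P) @^-1` U).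
Proof.
move=> cM cP cK sK coK JT KM KT U; split=> [[Uup oU] n|oU].
  split.
    apply/seteqP; split=> [x Ux|x [a Ua ax]]; first by exists x.
    by rewrite /= Uup; exists (val a).
  move=> D dD x sD Ux.
  have sD' := carried_supremums _ _ _ _ _ (cK n) (coK n) dD sD.
  have [_ [[y Dy <-] Uy]] := oU _ (subposet_directed _ _ dD) _ sD' Ux.
  by exists y.
have Uup x y : U x -> x <= y -> U y.
  move=> Ux xy; have [n _ Kx] : (\bigcup_n K n) x by rewrite -KT.
  have [m _ Ky] : (\bigcup_n K n) y by rewrite -KT.
  have Kx' := KM _ _ (leq_maxl n m) _ Kx; have Ky' := KM _ _ (leq_maxr n m) _ Ky.
  have [Uup _] := oU (maxn n m).
  suff : ((val : subposet (K (maxn n m)) -> P) @^-1` U)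
    (exist _ y (mem_set Ky')) by [].
  by rewrite Uup; exists (exist _ x (mem_set Kx')).
split.
  by apply/seteqP; split=> [x Ux|y [x Ux xy]]; [exists x | exact: Uup xy].
move=> D dD x sD Ux; have [[m Dm mD]|ngD] := pselect (has_greatest D).
  by exists m; split=> //; rewrite -(greatest_supremums _ _ _ Dm mD sD).
have [i _ Di] := cP D (fun _ _ => Logic.I) dD ngD; have [n Ji] := JT i.
(* U is an upper set, so it meets D as soon as it meets the chain *)
suff [_ [[k _ <-] Uk]] : range (c i) `&` U !=set0.
  have : down D (c i k) by rewrite Di; apply: sub_down; exists k.
  by move=> [y [Dy ky]]; exists y; split=> //; exact: Uup ky.
have Kc : range (c i) `<=` K n by move=> y cy; apply: (sK n i Ji); left.
move: sD; rewrite (supremums_down _ _ Di) => sc.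
have Kx : K n x by apply: (sK n i Ji); right.
have [_ /(_ ((val : subposet (K n) -> P) @^-1` range (c i)))] := oU n.
move=> /(_ _ (exist _ x (mem_set Kx))) [|||y [cy Uy]] //.
- exact/subposet_preimage_directed/chain_directed.
- case: sc => xc lx; split=> [y cy|u uc]; first exact: xc.
  by apply: lx => y cy; apply: (uc (exist _ y (mem_set (Kc y cy)))).
by exists (val y).
Qed.

Theorem theorem4p22 (d : Order.disp_t) (P : porderType d)
    (N : set nat) (I : N -> set P) (c : N -> nat -> P) (T : nat -> set P)
    (HI : [set A : set P | nontrivial_ideal A] = [set I n | n in [set: N]])
    (Hc : forall n m, c n m < c n m.+1)
    (HIc : forall n, I n = down [set c n m | m in [set: nat]])
    (HT : [set: P] `\` \bigcup_(n in [set: N]) with_sup (c n) =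
          \bigcup_(l in [set: nat]) T l)
    (HTid : forall l, [set A : set (subposet (T l)) | ideal A] =
          [set principal_ideal x | x in [set: subposet (T l)]]) :
  lf_omega_poset P /\ (dcpo P -> lf_omega_dcpo P).
Proof.
have cM i : {homo c i : m n / (m <= n)%N >-> m <= n}.
  by apply: homo_leq => [x|y x z|m]; [exact: lexx|exact: le_trans|exact: ltW].
have noeT l : noetherian (T l).
  apply: principal_ideals_noetherian => B.
  by have := HTid l; rewrite predeqE => /(_ B)[].
(* S i keeps c i from acquiring new suprema, and adds no non-trivial ideals *)
have [S SP] := choice (fun i : N =>
  noetherian_coinitial (ubound (range (c i)))).
pose J n : set N := [set i | (val i < n.+1)%N].
have finJ n : finite_set (J n).
  by apply: (finite_preimage (f := val) _ (finite_II n.+1)) => ? ? _ _ /val_inj.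
pose F n : set (set P) := [set with_sup (c i) | i in J n] `|`
  ([set S i | i in J n] `|` [set T l | l in `I_n.+1]).
pose K n := \bigcup_(A in F n) A.
have finF n : finite_set (F n).
  by rewrite !finite_setU; do !split; apply: finite_image => //; exact: finite_II.
have cK n : carried (J n) c (K n).
  apply: carried_bigcup => // A [[i Ji <-]|[[i Ji <-]|[l _ <-]]].
  - by right; exists i.
  - by left; have [] := SP i.
  - by left; exact: noeT.
have sK n i : J n i -> with_sup (c i) `<=` K n.
  by move=> Ji x cx; exists (with_sup (c i)) => //; left; exists i.
have coK n i b : J n i -> ubound (range (c i)) b ->
    exists2 s, K n s & ubound (range (c i)) s /\ s <= b.
  move=> Ji cb; have [Sc _ coS] := SP i; have [s Ss sb] := coS b cb.
  by exists s; [exists (S i) => //; right; left; exists i | split=> //; exact: Sc].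
have KM n m : (n <= m)%N -> K n `<=` K m.
  move=> nm; apply: bigcup_subset => A.
  case=> [[i Ji <-]|[[i Ji <-]|[l ln <-]]]; [left|right; left|right; right].
  - by exists i => //; apply: leq_trans Ji _.
  - by exists i => //; apply: leq_trans Ji _.
  - by exists l => //; apply: leq_trans ln _.
have KT : [set: P] = \bigcup_n K n.
  apply/seteqP; split=> // x _.
  have [[i _ cx]|nc] := pselect ((\bigcup_(n in [set: N]) with_sup (c n)) x).
    by exists (val i) => //; apply: (sK _ i) => //; exact: ltnSn.
  have [l _ Tx] : (\bigcup_(l in [set: nat]) T l) x by rewrite -HT.
  exists l => //; exists (T l) => //; right; right; exists l => //; exact: ltnSn.
have cP : carried setT c [set: P].
  move=> D _ dD ngD; have : nontrivial_ideal (down D).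
    split; first exact: ideal_down.
    by move=> [x _ xD]; apply: ngD; apply: (principal_greatest D x).
  have := HI; rewrite predeqE => /(_ (down D))[+ _] => /[apply] -[i _ <-].
  by exists i.
have subK n : d_sub_poset (K n) by exact: carried_d_sub_poset (cK n) (sK n).
have seqK : lf_omega_seq K.
  split=> // [n|]; first exact: carried_locally_finite (finJ n) (cK n) (sK n).
  apply: (scott_open_bigcup c J) => // i; exists (val i); exact: ltnSn.
split; first by exists K.
move=> dcpoP; split=> //; exists K; split=> // n D DK dD.
by have [x sD] := dcpoP D dD; exists x => //; exact: (subK n D).
Qed.
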